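(* Let $I\subset S$ be a $k$-clean monomial ideal. Then its radical $\sqrt{I}$ is $k$-clean.
   Context: $S=K[x_1,\dots,x_n]$ is a polynomial ring over a field $K$. For a monomial $u=x_1^{a_1}\cdots x_n^{a_n}$, $\mathrm{supp}(u)=\{i: a_i>0\}$. For an ideal $I$, $\min(I)$ denotes the set of minimal prime ideals of $I$. A monomial $u\neq 1$ with $u\notin I$ is a cleaner monomial of the monomial ideal $I$ if $\min(I+Su)\subseteq \min(I)$. For an integer $k\ge 0$, the class of $k$-clean monomial ideals is defined recursively (as the smallest class closed under the following rule): a proper monomial ideal $I$ is $k$-clean if either $I$ is a prime ideal, or $I$ has no embedded prime ideals (i.e. $\mathrm{Ass}(S/I)=\min(I)$) and there exists a cleaner monomial $u$ of $I$ with $|\mathrm{supp}(u)|\le k+1$ such that both $I:u$ and $I+Su$ are $k$-clean. *)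

(* Defs.v *)
From HB Require Import structures.
From mathcomp Require Import all_boot all_order all_algebra.
Set Implicit Arguments. Unset Strict Implicit. Unset Printing Implicit Defensive.
Import GRing.Theory.
Local Open Scope ring_scope.

Fixpoint mpoly (K : fieldType) (n : nat) : idomainType :=
  match n with
  | 0 => K
  | m.+1 => {poly (mpoly K m)}
  end.

(* the variable x_{i+1} (0-based index i < n) of mpoly K n *)
Fixpoint mvar (K : fieldType) (n i : nat) : mpoly K n :=
  match n return mpoly K n with
  | 0 => 0
  | m.+1 => if i == m then ('X : {poly mpoly K m}) else (mvar K m i)%:P
  end.

Definition mono (K : fieldType) (n : nat) (a : 'I_n -> nat) : mpoly K n :=
  \prod_(i < n) mvar K n i ^+ a i.

Definition supp_card (n : nat) (a : 'I_n -> nat) : nat := #|[pred i | 0 < a i]|%N.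

Section Ideals.
Variables (R : comNzRingType).

Definition is_ideal (I : R -> Prop) : Prop :=
  I 0 /\ (forall x y, I x -> I y -> I (x + y)) /\ (forall r x, I x -> I (r * x)).

Definition proper (I : R -> Prop) : Prop := is_ideal I /\ ~ I 1.

Definition subideal (I J : R -> Prop) : Prop := forall x, I x -> J x.

Definition same_ideal (I J : R -> Prop) : Prop := forall x, I x <-> J x.

Definition gen_ideal (G : R -> Prop) : R -> Prop :=
  fun x => forall J, is_ideal J -> subideal G J -> J x.

Definition prime_ideal (P : R -> Prop) : Prop :=
  proper P /\ (forall a b, P (a * b) -> P a \/ P b).

Definition min_prime (I P : R -> Prop) : Prop :=
  prime_ideal P /\ subideal I P /\
  (forall Q, prime_ideal Q -> subideal I Q -> subideal Q P -> same_ideal Q P).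

Definition colon (I : R -> Prop) (f : R) : R -> Prop := fun x => I (x * f).

Definition add_principal (I : R -> Prop) (f : R) : R -> Prop :=
  fun x => exists a b, I a /\ x = a + b * f.

Definition radical (I : R -> Prop) : R -> Prop := fun x => exists m, I (x ^+ m).

(* P \in Ass(S/I): P is a prime of the form Ann(f + I) = I : f *)
Definition ass_prime (I P : R -> Prop) : Prop :=
  prime_ideal P /\ exists f, same_ideal P (colon I f).

Definition no_embedded (I : R -> Prop) : Prop :=
  forall P, ass_prime I P <-> min_prime I P.

End Ideals.

Section Monomial.
Variables (K : fieldType) (n : nat).
Local Notation S := (mpoly K n).

Definition monomial_ideal (I : S -> Prop) : Prop :=
  is_ideal I /\
  exists M : ('I_n -> nat) -> Prop,
    same_ideal I (gen_ideal (fun x => exists a, M a /\ x = mono K a)).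

Definition cleaner (I : S -> Prop) (a : 'I_n -> nat) : Prop :=
  mono K a <> 1 /\ ~ I (mono K a) /\
  (forall P, min_prime (add_principal I (mono K a)) P -> min_prime I P).

Inductive kclean (k : nat) : (S -> Prop) -> Prop :=
  | kclean_prime (I : S -> Prop) :
      monomial_ideal I -> proper I -> prime_ideal I -> kclean k I
  | kclean_step (I : S -> Prop) (a : 'I_n -> nat) :
      monomial_ideal I -> proper I -> no_embedded I ->
      cleaner I a -> (supp_card a <= k.+1)%N ->
      kclean k (colon I (mono K a)) ->
      kclean k (add_principal I (mono K a)) ->
      kclean k I.

End Monomial.

(* Main.v *)
(* For a k-clean ideal I and a monomial w outside I, the colon I : w is again
   k-clean.  Given this, let u be the cleaner monomial of a non-prime k-clean I
   and v its squarefree part.  Then rad(I + Su) = rad(I) + Sv, because the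
   radical of a monomial ideal is monomial, and rad(I) : v = rad(I : u) : v, so
   that v is a cleaner monomial of rad(I), unless v lies in rad(I), in which
   case rad(I + Su) = rad(I).  No Noetherian argument is needed to see that
   minimal primes are associated: this property passes from the two branches
   L : u and L + Su to L. *)
Require Import Defs.
From mathcomp Require Import all_boot all_order all_algebra.
From Stdlib Require Import Classical FunctionalExtensionality PropExtensionality.
Set Implicit Arguments. Unset Strict Implicit. Unset Printing Implicit Defensive.
Import GRing.Theory.
Local Open Scope ring_scope.

(** * Colons, radicals, minimal and associated primes in a commutative ring *)

Section IdealTheory.
Variable R : comNzRingType.
Implicit Types (I J L P Q : R -> Prop) (f u v x y : R).

(** [kclean] is a predicate on ideals as functions, so ideals with the same elements are identified
    outright and can then be rewritten. *)
Lemma same_idealE I J : same_ideal I J -> I = J.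
Proof.
move=> h; apply: functional_extensionality => x.
exact: propositional_extensionality.
Qed.

Lemma is_ideal0 I : is_ideal I -> I 0. Proof. by case. Qed.
Lemma is_idealD I x y : is_ideal I -> I x -> I y -> I (x + y).
Proof. by case=> _ [h _]; apply: h. Qed.
Lemma is_idealMl I x y : is_ideal I -> I y -> I (x * y).
Proof. by case=> _ [_ h]; apply: h. Qed.
Lemma is_idealMr I x y : is_ideal I -> I x -> I (x * y).
Proof. by rewrite mulrC; apply: is_idealMl. Qed.

Lemma is_ideal_sum I (T : Type) (r : seq T) (p : pred T) (F : T -> R) :
  is_ideal I -> (forall i, p i -> I (F i)) -> I (\sum_(i <- r | p i) F i).
Proof.
move=> iI h; apply: (big_ind I) => //; first exact: is_ideal0.
by move=> x y; apply: is_idealD.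
Qed.

Lemma ideal_colon I f : is_ideal I -> is_ideal (colon I f).
Proof.
move=> iI; rewrite /colon; split; first by rewrite mul0r; apply: is_ideal0.
split=> [x y Ix Iy|r x Ix]; first by rewrite mulrDl; apply: is_idealD.
by rewrite -mulrA; apply: is_idealMl.
Qed.

Lemma ideal_add_principal I f : is_ideal I -> is_ideal (add_principal I f).
Proof.
move=> iI; split; first by exists 0, 0; rewrite mul0r addr0; split=> //; apply: is_ideal0.
split=> [_ _ [a [b [Ia ->]]] [c [d [Ic ->]]]|r _ [a [b [Ia ->]]]].
  by exists (a + c), (b + d); rewrite mulrDl addrACA; split=> //; apply: is_idealD.
by exists (r * a), (r * b); rewrite mulrDr mulrA; split=> //; apply: is_idealMl.
Qed.

Lemma sub_add_principal I f : subideal I (add_principal I f).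
Proof. by move=> x Ix; exists x, 0; rewrite mul0r addr0. Qed.

Lemma mem_add_principal I f : is_ideal I -> add_principal I f f.
Proof. by move=> iI; exists 0, 1; rewrite mul1r add0r; split=> //; apply: is_ideal0. Qed.

Lemma add_principal_sub I J f :
  is_ideal J -> subideal I J -> J f -> subideal (add_principal I f) J.
Proof.
by move=> iJ sIJ Jf _ [a [b [/sIJ Ja ->]]]; apply: is_idealD => //; apply: is_idealMl.
Qed.

Lemma sub_colon I f : is_ideal I -> subideal I (colon I f).
Proof. by move=> iI x Ix; apply: is_idealMr. Qed.

Lemma colon_colon I f g : colon (colon I f) g = colon I (f * g).
Proof.
by apply: functional_extensionality => x; rewrite /colon mulrAC mulrA.
Qed.

Lemma sub_radical I : subideal I (radical I).
Proof. by move=> x Ix; exists 1%N. Qed.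

Lemma radical_sub I J : subideal I J -> subideal (radical I) (radical J).
Proof. by move=> s x [m /s Jx]; exists m. Qed.

Lemma radicalX I x m : radical I (x ^+ m) -> radical I x.
Proof. by case=> p; rewrite -exprM => Ix; exists (m * p)%N. Qed.

Lemma ideal_radical I : is_ideal I -> is_ideal (radical I).
Proof.
move=> iI; split; first by exists 1%N; apply: is_ideal0.
split=> [x y [p Ix] [q Iy]|r x [p Ix]]; last first.
  by exists p; rewrite exprMn; apply: is_idealMl.
exists (p + q)%N; rewrite exprDn; apply: is_ideal_sum => // i _.
rewrite -mulr_natr; apply: is_idealMr => //.
case: (leqP q i) => [le_qi|lt_iq].
  by apply: is_idealMl => //; rewrite -(subnK le_qi) exprD; apply: is_idealMl.
apply: is_idealMr => //.
by rewrite -(addnBA _ (ltnW lt_iq)) exprD; apply: is_idealMr.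
Qed.

Lemma prime_ideal_is_ideal P : prime_ideal P -> is_ideal P.
Proof. by case=> -[]. Qed.

Lemma prime_idealX P x m : prime_ideal P -> P (x ^+ m) -> P x.
Proof.
move=> [[_ P1] pP]; elim: m => [|m IH]; first by rewrite expr0 => /P1.
by rewrite exprS => /pP [].
Qed.

Lemma radical_sub_prime I P :
  prime_ideal P -> subideal I P -> subideal (radical I) P.
Proof. by move=> pP s x [m /s]; apply: prime_idealX. Qed.

Lemma radical_prime P : prime_ideal P -> radical P = P.
Proof.
move=> pP; apply: same_idealE => x; split; last exact: sub_radical.
exact: radical_sub_prime pP _ _.
Qed.

Lemma min_prime_radical I P : min_prime (radical I) P <-> min_prime I P.
Proof.
split=> -[pP [sIP mP]]; split=> //; split.
- by move=> x /sub_radical /sIP.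
- move=> Q pQ sIQ; apply: mP => //; exact: radical_sub_prime.
- exact: radical_sub_prime.
by move=> Q pQ sIQ; apply: mP => // x /sub_radical /sIQ.
Qed.

Lemma min_prime_sub I L P :
  subideal I L -> subideal L P -> min_prime I P -> min_prime L P.
Proof.
move=> sIL sLP [pP [_ mP]]; split=> //; split=> // Q pQ sLQ; apply: mP => // x.
by move=> /sIL /sLQ.
Qed.

Lemma ass_prime_sub I P : is_ideal I -> ass_prime I P -> subideal I P.
Proof. by move=> iI [_ [f hf]] x Ix; apply/hf; apply: sub_colon. Qed.

Lemma ass_prime_colon I w P : ass_prime (colon I w) P -> ass_prime I P.
Proof. by case=> pP [f]; rewrite colon_colon => hf; split=> //; exists (w * f). Qed.

(** For [f] outside a prime [P], the colon [P : f] is [P] again, and for [f] inside it is the unit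
    ideal. So [P] is its only associated prime and its only minimal prime. *)
Lemma no_embedded_prime P : prime_ideal P -> no_embedded P.
Proof.
move=> pP Q; have iP := prime_ideal_is_ideal pP; split=> [aQ|[pQ [sPQ mQ]]].
  have sPQ := ass_prime_sub iP aQ.
  case: aQ => pQ [f hf]; split=> //; split=> // Q' pQ' sPQ' sQ' x; split; first exact: sQ'.
  move=> /hf; rewrite /colon => /(proj2 pP) [/sPQ' //|Pf].
  by case: pQ => -[_ []]; apply/hf; rewrite /colon mul1r.
split=> //; exists 1 => x; rewrite /colon mulr1; split; last exact: sPQ.
by move=> Qx; apply/(mQ _ pP).
Qed.

(* If [z u \in L] for some [z] outside [P], then [P = (L + Ru) : f] is also
   [L : (z f)]; otherwise [L : u] is contained in [P]. *)
Lemma min_prime_ass L u P :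
    is_ideal L ->
    no_embedded (colon L u) -> no_embedded (add_principal L u) ->
  min_prime L P -> ass_prime L P.
Proof.
move=> iL neC neA mP; have [pP [sLP _]] := mP; have iP := prime_ideal_is_ideal pP.
case: (classic (subideal (colon L u) P)) => [sCP|].
  apply: (@ass_prime_colon _ u); apply/neC; apply: min_prime_sub mP => //.
  exact: sub_colon.
move=> nsCP; have [z nz] := not_all_ex_not _ _ nsCP.
have [Lzu nPz] := imply_to_and _ _ nz.
have Pu : P u by case: (proj2 pP _ _ (sLP _ Lzu)) => // /nPz.
have /neA [_ [f hf]] : min_prime (add_principal L u) P.
  apply: (min_prime_sub _ _ mP); first exact: sub_add_principal.
  exact: add_principal_sub.
split=> //; exists (z * f) => x; split=> [/hf [a [b [La e]]]|].
  rewrite /colon mulrCA e mulrDr; apply: is_idealD => //; first exact: is_idealMl.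
  by rewrite mulrCA; apply: is_idealMl.
rewrite /colon mulrA => Lxzf.
have /hf/(proj2 pP) [//|/nPz //] : colon (add_principal L u) f (x * z).
exact: sub_add_principal.
Qed.

(** Let [J] be the radical and [P = J : f]. If [f] were in [P], then [f * f] and hence [f] would lie
    in [J], and [P] would contain 1. So [f] avoids every prime [Q] between [J] and [P], and [x * f]
    in [J] forces [x] into [Q]. *)
Lemma ass_prime_radical I P :
  is_ideal I -> ass_prime (radical I) P -> min_prime (radical I) P.
Proof.
move=> iI aP; have iJ := ideal_radical iI; have sJP := ass_prime_sub iJ aP.
case: aP => pP [f hf]; split=> //; split=> // Q pQ sJQ sQP x; split; first exact: sQP.
move=> /hf /sJQ /(proj2 pQ) [//|/sQP /hf Jff].
have Jf : radical I f by apply: (@radicalX _ _ 2).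
by case: pP => -[_ []]; apply/hf; rewrite /colon mul1r.
Qed.

(** Multiplying a power of [x * v] by [N] further factors supplies [v ^+ N], and with it the factor
    [u] that separates [I : u] from [I]. *)
Lemma radical_colon I u v N r :
  is_ideal I -> v ^+ N = r * u ->
  colon (radical (colon I u)) v = colon (radical I) v.
Proof.
move=> iI e; apply: same_idealE => x; split=> -[m Im]; last first.
  by exists m; apply: sub_colon.
exists (m + N)%N; rewrite exprD (exprMn N) e (mulrA (x ^+ N)) mulrCA.
exact: is_idealMl.
Qed.

Lemma radical_add_principal_mem I u :
  is_ideal I -> radical I u -> radical (add_principal I u) = radical I.
Proof.
move=> iI Ju; have iJ := ideal_radical iI.
apply: same_idealE => x; split; last by apply: radical_sub; apply: sub_add_principal.
case=> m h; apply: (@radicalX _ _ m); move: h; apply: add_principal_sub => //.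
exact: sub_radical.
Qed.

End IdealTheory.

(** * Monomials and coefficients in iterated polynomial rings *)

Section Coefficients.
Variable K : fieldType.

(** The outermost variable of [mpoly K n.+1] is the last one, so exponent vectors are taken apart
    and built at [ord_max]. *)
Definition exp_init (n : nat) (a : 'I_n.+1 -> nat) : 'I_n -> nat :=
  fun i => a (lift ord_max i).

Definition exp_rcons (n : nat) (a : 'I_n -> nat) (d : nat) : 'I_n.+1 -> nat :=
  fun i => oapp a d (unlift ord_max i).

Fixpoint mconst (n : nat) (c : K) : mpoly K n :=
  match n return mpoly K n with
  | 0 => c
  | m.+1 => (mconst m c)%:P
  end.

Fixpoint mcoef (n : nat) : ('I_n -> nat) -> mpoly K n -> K :=
  match n return ('I_n -> nat) -> mpoly K n -> K with
  | 0 => fun _ f => f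
  | m.+1 => fun a f => mcoef (exp_init a) (f : {poly mpoly K m})`_(a ord_max)
  end.

Definition mterm (n : nat) (a : 'I_n -> nat) (f : mpoly K n) : mpoly K n :=
  mconst n (mcoef a f) * mono K a.

Lemma exp_rconsK n (a : 'I_n -> nat) d : exp_init (exp_rcons a d) = a.
Proof. by apply: functional_extensionality => i; rewrite /exp_init /exp_rcons liftK. Qed.

Lemma exp_rcons_max n (a : 'I_n -> nat) d : exp_rcons a d ord_max = d.
Proof. by rewrite /exp_rcons unlift_none. Qed.

Lemma monoS n (a : 'I_n.+1 -> nat) :
  mono K a = (mono K (exp_init a))%:P * 'X^(a ord_max) :> {poly mpoly K n}.
Proof.
rewrite /mono big_ord_recr /= eqxx rmorph_prod; congr (_ * _).
apply: eq_bigr => i _; rewrite ltn_eqF // rmorphXn /=; congr (_ ^+ a _).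
by apply: val_inj; exact/esym/lift_max.
Qed.

Lemma mono_exp0 n : mono K (fun _ : 'I_n => 0%N) = 1.
Proof. by rewrite /mono big1. Qed.

Lemma monoD n (a b : 'I_n -> nat) :
  mono K (fun i => (a i + b i)%N) = mono K a * mono K b.
Proof. by rewrite /mono -big_split; apply: eq_bigr => i _; rewrite exprD. Qed.

Lemma monoX n (a : 'I_n -> nat) m : mono K (fun i => (a i * m)%N) = mono K a ^+ m.
Proof. by rewrite /mono -prodrXl; apply: eq_bigr => i _; rewrite exprM. Qed.

Lemma mconst0 n : mconst n 0 = 0.
Proof. by elim: n => //= n ->; rewrite polyC0. Qed.

Lemma mconst1 n : mconst n 1 = 1.
Proof. by elim: n => //= n ->; rewrite polyC1. Qed.

Lemma mconstM n c d : mconst n (c * d) = mconst n c * mconst n d.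
Proof. by elim: n => //= n ->; rewrite polyCM. Qed.

Lemma mcoef0 n (a : 'I_n -> nat) : mcoef a 0 = 0.
Proof. by elim: n a => //= n IH a; rewrite coef0 IH. Qed.

Lemma mcoefD n (a : 'I_n -> nat) f g : mcoef a (f + g) = mcoef a f + mcoef a g.
Proof. by elim: n a f g => //= n IH a f g; rewrite coefD IH. Qed.

Lemma mcoef_const n (a : 'I_n -> nat) c :
  mcoef a (mconst n c) != 0 -> a = fun=> 0%N.
Proof.
move=> h; apply: functional_extensionality.
elim: n a h => [|n IH] a /= h i; first by case: i.
move: h; rewrite coefC; case: (a ord_max =P 0%N) => [a0|_]; last by rewrite mcoef0 eqxx.
move=> /IH h; case: (unliftP ord_max i) => [j|] -> //; exact: h.
Qed.

Lemma mcoef_const0 n c : mcoef (fun=> 0%N) (mconst n c) = c.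
Proof. by elim: n => //= n IH; rewrite coefC eqxx. Qed.

Lemma mcoefM_mono n (a b : 'I_n -> nat) f :
  mcoef (fun i => (b i + a i)%N) (f * mono K a) = mcoef b f.
Proof.
elim: n a b f => [|n IH] a b f; first by rewrite /mono big_ord0 mulr1.
rewrite monoS /= mulrA coefMXn ltnNge leq_addl /= addnK coefMC.
exact: (IH (exp_init a) (exp_init b)).
Qed.

Lemma mcoefM_mono_neq0 n (a b : 'I_n -> nat) f :
  mcoef b (f * mono K a) != 0 -> forall i, (a i <= b i)%N.
Proof.
elim: n a b f => [|n IH] a b f; first by move=> _ [].
rewrite monoS /= mulrA coefMXn; case: ltnP => [_|le_ab]; first by rewrite mcoef0 eqxx.
rewrite coefMC => /IH h i; case: (unliftP ord_max i) => [j|] -> //; exact: h.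
Qed.

Lemma exp_subK n (a b : 'I_n -> nat) :
  (forall i, (a i <= b i)%N) -> b = fun i => (b i - a i + a i)%N.
Proof. by move=> le_ab; apply: functional_extensionality => i; rewrite subnK. Qed.

Lemma mcoef_mono_neq0 n (a b : 'I_n -> nat) c :
  mcoef b (mconst n c * mono K a) != 0 -> b = a.
Proof.
move=> h; have le_ab := mcoefM_mono_neq0 h; move: h.
rewrite [in mcoef b](exp_subK le_ab) mcoefM_mono => /mcoef_const /= e.
apply: functional_extensionality => i; apply/eqP; rewrite eqn_leq le_ab andbT.
by rewrite -subn_eq0 -[(_ - _)%N]/((fun i => b i - a i)%N i) e.
Qed.

Lemma mcoef_mono n (a : 'I_n -> nat) : mcoef a (mono K a) = 1.
Proof.
have e : a = fun i => (0 + a i)%N by apply: functional_extensionality.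
by rewrite [in mcoef a]e -[mono K a]mul1r mcoefM_mono -mconst1 mcoef_const0.
Qed.

Lemma mono_eq1 n (a : 'I_n -> nat) : mono K a = 1 -> a = fun=> 0%N.
Proof.
move=> e; apply: (@mcoef_const n a 1).
by rewrite mconst1 -e mcoef_mono oner_neq0.
Qed.

Lemma mterm_rcons n (a : 'I_n -> nat) d (f : mpoly K n.+1) :
  mterm (exp_rcons a d) f = (mterm a (f : {poly mpoly K n})`_d)%:P * 'X^d.
Proof. by rewrite /mterm monoS /= exp_rconsK exp_rcons_max polyCM mulrA. Qed.

Lemma mtermS n (a : 'I_n.+1 -> nat) (f : mpoly K n.+1) :
  mterm a f = (mterm (exp_init a) (f : {poly mpoly K n})`_(a ord_max))%:P * 'X^(a ord_max).
Proof. by rewrite /mterm monoS /= polyCM mulrA. Qed.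

(** An additive subgroup. This property passes to slices such as [fun c => J (c%:P * 'X^i)], as the
    inductions on the number of variables require. *)
Definition sub_closed (V : zmodType) (J : V -> Prop) : Prop :=
  J 0 /\ forall x y, J x -> J y -> J (x - y).

Lemma sub_closedD (V : zmodType) (J : V -> Prop) x y :
  sub_closed J -> J x -> J y -> J (x + y).
Proof.
by move=> [J0 JB] Jx Jy; rewrite -[y]opprK; apply: (JB) => //; rewrite -sub0r; apply: JB.
Qed.

Lemma is_ideal_sub_closed (R : comNzRingType) (I : R -> Prop) :
  is_ideal I -> sub_closed I.
Proof.
move=> iI; split; first exact: is_ideal0.
move=> x y Ix Iy; rewrite -mulN1r; apply: is_idealD => //; exact: is_idealMl.
Qed.

(** Every polynomial is the sum of its terms. The induction expands [f] in the last variable and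
    treats each coefficient inside the slice of [J] in that degree. *)
Lemma mterm_closed n (J : mpoly K n -> Prop) f :
  sub_closed J -> (forall a, J (mterm a f)) -> J f.
Proof.
elim: n J f => [|n IH] J f sJ h.
  by have := h (fun=> 0%N); rewrite /mterm /mono big_ord0 mulr1.
rewrite -[f](@coefK (mpoly K n)) poly_def; apply: (big_ind J) => [||i _].
- by case: sJ.
- by move=> x y; apply: sub_closedD.
rewrite -mul_polyC; apply: (IH (fun c => J (c%:P * 'X^i))) => [|a].
  case: sJ => J0 JB; split; first by rewrite mul0r.
  by move=> x y Jx Jy; rewrite polyCB mulrBl; apply: JB.
by rewrite -mterm_rcons.
Qed.

(** Over a domain degrees multiply under powers. For [f = 0] the degree [(size f).-1] defaults to 0,
    and the formula still holds, also for [m = 0]. *)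
Lemma coef_exp_lead (R : idomainType) (f : {poly R}) m :
  (f ^+ m)`_((size f).-1 * m) = lead_coef f ^+ m.
Proof.
have [->|f0] := eqVneq f 0.
  by rewrite size_poly0 mul0n lead_coef0 -polyC0 -polyC_exp coefC.
by rewrite -lead_coef_exp lead_coefE size_exp.
Qed.

(* A family [I m], rather than one ideal, is needed because slicing the
   radical of an ideal along powers of the last variable leads from
   [f ^+ m \in I] to [c ^+ m] lying in the slice of degree [i * m]. *)
Lemma mterm_power_closed n (I : nat -> mpoly K n -> Prop) :
    (forall m, sub_closed (I m)) ->
    (forall m f a, I m f -> I m (mterm a f)) ->
    sub_closed (fun f => exists m, I m (f ^+ m)) ->
  forall f a, (exists m, I m (f ^+ m)) -> exists m, I m (mterm a f ^+ m).
Proof.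
elim: n I => [|n IH] I sI tI sJ f a Jf.
  by rewrite /mterm /mono big_ord0 mulr1.
pose J g := exists m, I m (g ^+ m).
have slice m (g : {poly mpoly K n}) i : I m g -> I m ((g`_i)%:P * 'X^i).
  move=> Ig; apply: (@mterm_closed _ (fun c => I m (c%:P * 'X^i))) => [|b].
    case: (sI m) => I0 IB; split; first by rewrite mul0r.
    by move=> x y Ix Iy; rewrite polyCB mulrBl; apply: IB.
  by rewrite -mterm_rcons; apply: tI.
(* The leading term of [g ^+ m] is the [m]-th power of that of [g], so the leading term of [g] lies
   in [J]. Subtracting it lowers the size, and induction reaches the other coefficients. *)
have coefJ (g : {poly mpoly K n}) i : J g -> J ((g`_i)%:P * 'X^i).
  have [s] := ubnP (size g); elim: s g i => // s IHs g i lt_gs Jg.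
  have [->|g0] := eqVneq g 0; first by rewrite coef0 mul0r; case: sJ.
  have Jlead : J ((lead_coef g)%:P * 'X^((size g).-1)).
    case: Jg => m Ig; exists m.
    by rewrite exprMn -exprM -polyC_exp -coef_exp_lead; apply: slice.
  have [->|ne_i] := eqVneq i (size g).-1; first by rewrite -lead_coefE.
  pose h := g - (lead_coef g)%:P * 'X^((size g).-1).
  have <- : h`_i = g`_i by rewrite coefB coefCM coefXn (negPf ne_i) mulr0 subr0.
  apply: IHs; last by case: sJ => _; apply.
  rewrite (leq_trans _ (lt_gs : (size g <= s)%N)) //.
  rewrite -[X in (_ < X)%N](prednK (n := size g)) ?size_poly_gt0 // ltnS.
  apply/leq_sizeP => j; rewrite leq_eqVlt coefB coefCM coefXn => /predU1P[<-|lt_j].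
    by rewrite eqxx mulr1 subrr.
  rewrite (gtn_eqF lt_j) mulr0 subr0 nth_default //.
  by rewrite -(prednK (n := size g)) ?size_poly_gt0.
set d := a ord_max.
have powE m (c : mpoly K n) : (c%:P * 'X^d) ^+ m = (c ^+ m)%:P * 'X^(d * m) :> {poly mpoly K n}.
  by rewrite exprMn -exprM -polyC_exp.
(* By [powE], [I' m (c ^+ m)] says that the [m]-th power of [c%:P * 'X^d] lies in [I m]. The radical
   of the family [I'] is thus the slice of [J] in degree [d]. *)
pose I' m c := I m (c%:P * 'X^(d * m)).
have [||||m] := IH I' _ _ _ (f : {poly mpoly K n})`_d (exp_init a).
- move=> m; case: (sI m) => I0 IB; split; first by rewrite /I' mul0r.
  by move=> x y Ix Iy; rewrite /I' polyCB mulrBl; apply: IB.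
- move=> m c b Ic; rewrite /I'.
  have := tI m _ (exp_rcons b (d * m)) Ic.
  by rewrite mterm_rcons coefMXn ltnn subnn coefC.
- split.
    by exists 1%N; rewrite /I' expr1 mul0r; case: (sI 1%N).
  move=> x y [p Ix] [q Iy].
  have [||m] := (proj2 sJ) (x%:P * 'X^d) (y%:P * 'X^d).
  + by exists p; rewrite powE.
  + by exists q; rewrite powE.
  by rewrite -mulrBl -polyCB powE => Im; exists m.
- by have [m] := coefJ f d Jf; rewrite powE => Im; exists m.
by move=> Im; exists m; rewrite mtermS powE.
Qed.

End Coefficients.

(** * Monomial ideals and their colons, sums and radicals *)

Section MonomialIdeals.
Variables (K : fieldType) (n : nat).
Local Notation S := (mpoly K n).
Implicit Types (I J : S -> Prop) (a b w e : 'I_n -> nat).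

(** For ideals this is equivalent to having monomial generators, and it turns closure properties of
    monomial ideals into checks on exponents. *)
Definition mono_tested I : Prop :=
  forall f, I f <-> forall e, mcoef e f != 0 -> I (mono K e).

Lemma mem_mterm I a f :
  is_ideal I -> mcoef a f != 0 -> I (mterm a f) -> I (mono K a).
Proof.
move=> iI nz If; rewrite -[mono K a]mul1r -mconst1 -(mulVf nz) mconstM -mulrA.
exact: is_idealMl.
Qed.

Lemma mterm_mem I a f :
  is_ideal I -> (mcoef a f != 0 -> I (mono K a)) -> I (mterm a f).
Proof.
move=> iI h; rewrite /mterm; have [->|/h Ia] := eqVneq (mcoef a f) 0.
  by rewrite mconst0 mul0r; apply: is_ideal0.
exact: is_idealMl.
Qed.

Lemma mono_testedI I :
  is_ideal I -> (forall f e, I f -> mcoef e f != 0 -> I (mono K e)) -> mono_tested I.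
Proof.
move=> iI h f; split=> [If e|hf]; first exact: h.
apply: mterm_closed => [|a]; first exact: is_ideal_sub_closed.
by apply: mterm_mem => // /hf.
Qed.

Lemma mcoefD_neq0 e (f g : S) :
  mcoef e (f + g) != 0 -> mcoef e f != 0 \/ mcoef e g != 0.
Proof.
rewrite mcoefD; have [->|] := eqVneq (mcoef e f) 0; last by left.
by rewrite add0r; right.
Qed.

(** By additivity, stability under multiplication need only be checked for one term of [r] against
    one term of [x]. There the exponents add, and [D] is closed upwards. *)
Lemma ideal_upset (D : ('I_n -> nat) -> Prop) :
  (forall a b, D a -> (forall i, a i <= b i)%N -> D b) ->
  is_ideal (fun f : S => forall e, mcoef e f != 0 -> D e).
Proof.
move=> upD; have DD (f g : S) : (forall e, mcoef e f != 0 -> D e) ->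
    (forall e, mcoef e g != 0 -> D e) -> forall e, mcoef e (f + g) != 0 -> D e.
  by move=> hf hg e /mcoefD_neq0 [/hf|/hg].
have D0 e : mcoef e (0 : S) != 0 -> D e by rewrite mcoef0 eqxx.
have Dopp (g : S) : (forall e, mcoef e g != 0 -> D e) ->
    forall e, mcoef e (- g) != 0 -> D e.
  move=> hg e nz; apply: hg; apply: contraNneq nz => gz.
  by have := mcoefD e g (- g); rewrite subrr mcoef0 gz add0r => <-.
split=> //; split=> [|r x hx]; first exact: DD.
apply: (mterm_closed (J := fun r => forall e, mcoef e (r * x) != 0 -> D e)) => [|a].
  split; first by rewrite mul0r.
  by move=> f g hf hg; rewrite mulrBl; apply: DD => //; apply: Dopp.
rewrite /mterm; move: (mcoef a r) => c.
apply: (mterm_closed (J := fun x =>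
  forall e, mcoef e (mconst n c * mono K a * x) != 0 -> D e)) => [|b].
  split; first by rewrite mulr0.
  by move=> f g hf hg; rewrite mulrBr; apply: DD => //; apply: Dopp.
move=> e; have [z|nz] := eqVneq (mcoef b x) 0.
  by rewrite /mterm z mconst0 mul0r mulr0 => /D0.
rewrite /mterm mulrACA -mconstM -monoD => /mcoef_mono_neq0 ->.
by apply: upD (hx b nz) _ => i; apply: leq_addl.
Qed.

(** The exponents of monomials in [I] are closed upwards, so they define an ideal by [ideal_upset].
    It contains the generators, hence all of [I]. Conversely, the monomials in [I] serve as
    generators. *)
Lemma monomial_idealP I : monomial_ideal I <-> is_ideal I /\ mono_tested I.
Proof.
split=> [[iI [M hM]]|[iI tI]]; split=> //.
  apply: mono_testedI => // f e /hM genf.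
  pose D e := I (mono K e).
  have upD a b : D a -> (forall i, a i <= b i)%N -> D b.
    move=> Da le_ab; rewrite /D (exp_subK le_ab) monoD; exact: is_idealMl.
  apply: (genf _ (ideal_upset upD)) => _ [a [Ma ->]] b.
  rewrite -[mono K a]mul1r -mconst1 => /mcoef_mono_neq0 ->.
  by apply/hM => J _; apply; exists a.
exists (fun a => I (mono K a)) => f; split=> [If J iJ sJ|]; last first.
  by apply=> // _ [a [Ia ->]].
apply: mterm_closed => [|a]; first exact: is_ideal_sub_closed.
by apply: mterm_mem => // nz; apply: sJ; exists a; split=> //; apply: (proj1 (tI f)).
Qed.

Lemma monomial_ideal_is_ideal I : monomial_ideal I -> is_ideal I.
Proof. by case. Qed.

Lemma monomial_idealE I J :
  monomial_ideal I -> monomial_ideal J ->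
  (forall e, I (mono K e) <-> J (mono K e)) -> I = J.
Proof.
move=> /monomial_idealP [_ tI] /monomial_idealP [_ tJ] h; apply: same_idealE => f.
by split=> [/tI hf|/tJ hf]; [apply/tJ|apply/tI] => e /hf /h.
Qed.

Lemma monomial_colon I w : monomial_ideal I -> monomial_ideal (colon I (mono K w)).
Proof.
move=> /monomial_idealP [iI tI]; apply/monomial_idealP; split; first exact: ideal_colon.
apply: mono_testedI; first exact: ideal_colon.
move=> f e /tI h nz; rewrite /colon -monoD; apply: h.
by rewrite mcoefM_mono.
Qed.

Lemma mono_add_principal I a e :
  monomial_ideal I ->
  add_principal I (mono K a) (mono K e) <-> I (mono K e) \/ forall i, (a i <= e i)%N.
Proof.
move=> /monomial_idealP [iI tI]; split=> [[x [y [Ix exy]]]|[Ie|le_ae]].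
- have : mcoef e (x + y * mono K a) != 0 by rewrite -exy mcoef_mono oner_neq0.
  case/mcoefD_neq0=> [nz|/mcoefM_mono_neq0]; last by right.
  by left; apply: (proj1 (tI x)) nz.
- exact: sub_add_principal.
rewrite (exp_subK le_ae) monoD; apply: is_idealMl; first exact: ideal_add_principal.
exact: mem_add_principal.
Qed.

Lemma monomial_add_principal I a :
  monomial_ideal I -> monomial_ideal (add_principal I (mono K a)).
Proof.
move=> mI; have /monomial_idealP [iI tI] := mI.
apply/monomial_idealP; split; first exact: ideal_add_principal.
apply: mono_testedI; first exact: ideal_add_principal.
move=> _ e [x [y [Ix ->]]] /mcoefD_neq0 [nz|/mcoefM_mono_neq0 le_ae].
  by apply: sub_add_principal; apply: (proj1 (tI x)).
by apply/mono_add_principal; last right.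
Qed.

(** The constant family [fun=> I] in [mterm_power_closed] shows that the radical contains each term
    of each of its elements. *)
Lemma monomial_radical I : monomial_ideal I -> monomial_ideal (radical I).
Proof.
move=> /monomial_idealP [iI tI]; have iJ := ideal_radical iI.
apply/monomial_idealP; split=> //; apply: mono_testedI => // f e Jf nz.
apply: mem_mterm (nz) _ => //.
apply: (mterm_power_closed (I := fun=> I)) Jf => [_|_ g a Ig|].
- exact: is_ideal_sub_closed.
- by apply: mterm_mem => //; apply: (proj1 (tI g)).
exact: is_ideal_sub_closed.
Qed.

(** The truncated difference is the exponent of [u / gcd(u, w)], and it is bounded by [e] exactly
    when [a] is bounded by [e + w]. *)
Lemma colon_add_principal I a w :
  monomial_ideal I ->
  add_principal (colon I (mono K w)) (mono K (fun i => a i - w i)%N)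
    = colon (add_principal I (mono K a)) (mono K w).
Proof.
move=> mI; apply: monomial_idealE => [||e].
- exact/monomial_add_principal/monomial_colon.
- exact/monomial_colon/monomial_add_principal.
rewrite mono_add_principal; last exact: monomial_colon.
rewrite /colon -monoD mono_add_principal //.
split=> -[Ie|le_ae]; [by left|right=> i|by left|right=> i]; have := le_ae i.
  by rewrite leq_subLR addnC.
by rewrite leq_subLR addnC.
Qed.

(** The boolean [0 < a i], read as 0 or 1, is the exponent of the squarefree part. A monomial has a
    power divisible by [mono K a] exactly when its support contains that of [a]. *)
Lemma radical_add_principal I a :
  monomial_ideal I ->
  radical (add_principal I (mono K a))
    = add_principal (radical I) (mono K (fun i => 0 < a i)%N).
Proof.
move=> mI; have iI := monomial_ideal_is_ideal mI; have mJ := monomial_radical mI.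
apply: monomial_idealE => [||e].
- exact/monomial_radical/monomial_add_principal.
- exact: monomial_add_principal.
rewrite mono_add_principal //; split=> [[m]|[[m Ie]|le_ae]].
- rewrite -monoX mono_add_principal // => -[Ie|le_ae].
    by left; exists m; rewrite -monoX.
  right=> i; have := le_ae i; case: (a i) => // d; case: (e i) => //.
- by exists m; apply: sub_add_principal.
(* This power raises every positive exponent to at least the largest entry of [a]. *)
exists (\max_i a i)%N; rewrite -monoX mono_add_principal //; right=> i.
have := le_ae i; case: (posnP (a i)) => [-> //|_ e0].
by rewrite (leq_trans (leq_bigmax i)) // leq_pmull.
Qed.

End MonomialIdeals.

(** * Colons of k-clean ideals by monomials *)

Section KClean.
Variables (K : fieldType) (n k : nat).
Implicit Types (I : mpoly K n -> Prop) (a w : 'I_n -> nat).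

Lemma kclean_no_embedded I : kclean k I -> no_embedded I.
Proof. by case=> // J _ _; apply: no_embedded_prime. Qed.

Lemma colon_proper I (f : mpoly K n) : is_ideal I -> ~ I f -> Defs.proper (colon I f).
Proof. by move=> iI nIf; split; [exact: ideal_colon | rewrite /colon mul1r]. Qed.

Lemma supp_card_le a b : (forall i, 0 < a i -> 0 < b i)%N -> (supp_card a <= supp_card b)%N.
Proof. by move=> h; apply: subset_leq_card; apply/subsetP => i; apply: h. Qed.

(* With [g = gcd u w] and [u' = u / g], the two branches of [I : w] at [u'] are
   [(I : w) : u' = (I : u) : (w / g)] and [(I : w) + Su' = (I + Su) : w]. *)
Lemma kclean_colon I w :
  kclean k I -> ~ I (mono K w) -> kclean k (colon I (mono K w)).
Proof.
move=> cI; elim: cI w => {I}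
  [I mI prI pI w nIw|I a mI prI neI [a1 [nIa mina]] suppa cC IHC cA IHA w nIw].
  suff -> : colon I (mono K w) = I by apply: kclean_prime.
  have iI := monomial_ideal_is_ideal mI.
  apply: same_idealE => x; split; last exact: sub_colon.
  by case/(proj2 pI).
have iI := monomial_ideal_is_ideal mI.
set u' := fun i => (a i - w i)%N; set w' := fun i => (w i - a i)%N.
(* Both products are the least common multiple, with exponents [maxn (a i) (w i)]. *)
have lcmE : mono K w * mono K u' = mono K a * mono K w'.
  rewrite -!monoD; congr mono; apply: functional_extensionality => i.
  by rewrite -!maxnE maxnC.
have colonE : colon (colon I (mono K w)) (mono K u')
    = colon (colon I (mono K a)) (mono K w') by rewrite !colon_colon lcmE.
(* If [u] divides [w], then [u'] is 1 and cannot be a cleaner. In that case [I : w] is itself a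
   colon of [I : u]. *)
case: (classic (u' = fun=> 0%N)) => [u'0|u'n0].
  have -> : colon I (mono K w) = colon (colon I (mono K a)) (mono K w').
    by rewrite -colonE u'0 colon_colon mono_exp0 mulr1.
  apply: IHC; rewrite /colon mulrC -lcmE u'0 mono_exp0 mulr1.
  exact: nIw.
have nAw : ~ add_principal I (mono K a) (mono K w).
  rewrite mono_add_principal // => -[//|le_aw]; apply: u'n0.
  by apply: functional_extensionality => i; apply/eqP; rewrite subn_eq0.
have addE := colon_add_principal a w mI.
have cA' := IHA _ nAw.
have mL := monomial_colon w mI; have iL := monomial_ideal_is_ideal mL.
(* If the least common multiple is in [I], then [u'] already lies in [I : w], so adding it changes
   nothing and [I : w] equals [(I + Su) : w]. *)
case: (classic (I (mono K w * mono K u'))) => [Ilcm|nIlcm].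
  suff <- : colon (add_principal I (mono K a)) (mono K w) = colon I (mono K w) by [].
  rewrite -addE; apply: same_idealE => x; split; last exact: sub_add_principal.
  by apply: add_principal_sub => //; rewrite /colon mulrC.
have cC' : kclean k (colon (colon I (mono K w)) (mono K u')).
  by rewrite colonE; apply: IHC; rewrite /colon mulrC -lcmE.
rewrite -addE in cA'.
have assL P : ass_prime (colon I (mono K w)) P -> min_prime (colon I (mono K w)) P.
  move=> aP; apply: (min_prime_sub (@sub_colon _ _ (mono K w) iI)); first exact: ass_prime_sub aP.
  by apply/neI; apply: ass_prime_colon aP.
apply: (@kclean_step _ _ _ _ u') => //.
- exact: colon_proper.
- move=> P; split; first exact: assL.
  by apply: min_prime_ass => //; apply: kclean_no_embedded; [exact: cC'|exact: cA'].
- split; first by move/mono_eq1.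
  split; first by rewrite /colon mulrC.
  (* A minimal prime of [(I + Su) : w] is associated to it, hence to [I + Su], hence minimal over
     [I + Su] and, [u] being a cleaner, over [I]. As it contains [I : w], it is minimal there
     too. *)
  move=> P mP; have [pP [sP _]] := mP.
  apply: (min_prime_sub (@sub_colon _ _ (mono K w) iI)).
    by move=> x Lx; apply: sP; apply: sub_add_principal.
  apply: mina; apply/(kclean_no_embedded cA); apply: (@ass_prime_colon _ _ (mono K w)).
  by rewrite -addE; apply/(kclean_no_embedded cA').
apply: leq_trans (supp_card_le _) suppa => i; rewrite subn_gt0; exact: leq_ltn_trans.
Qed.

End KClean.

(** * Passage to the radical *)

Theorem theorem3p2 (K : fieldType) (n k : nat) (I : mpoly K n -> Prop) :
  kclean k I -> kclean k (radical I).
Proof.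
elim=> {I} [I mI prI pI|I a mI prI neI [a1 [nIa mina]] suppa cC IHC cA IHA].
  by rewrite radical_prime //; apply: kclean_prime.
have iI := monomial_ideal_is_ideal mI.
have mJ := monomial_radical mI; have iJ := monomial_ideal_is_ideal mJ.
case: (classic (radical I (mono K a))) => [Ja|nJa].
  by rewrite -(radical_add_principal_mem iI Ja).
pose v i : nat := (0 < a i)%N.
(* The largest exponent of [u] makes this power of [v] a multiple of [u], as [radical_colon]
   demands. *)
have vE : mono K v ^+ (\max_i a i)%N
    = mono K (fun i => v i * (\max_i a i) - a i)%N * mono K a.
  rewrite -monoX -monoD; congr mono; apply: functional_extensionality => i.
  rewrite subnK // /v; case: (posnP (a i)) => [-> //|a0].
  by rewrite mul1n (leq_bigmax i).
have nJv : ~ radical I (mono K v).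
  have aE : a = fun i => (a i - v i + v i)%N by apply: exp_subK => i; rewrite /v; case: (a i).
  by move=> Jv; apply: nJa; rewrite aE monoD; apply: is_idealMl.
have addE := radical_add_principal a mI.
have cJA : kclean k (add_principal (radical I) (mono K v)) by rewrite -addE.
have cJC : kclean k (colon (radical I) (mono K v)).
  rewrite -(radical_colon iI vE); apply: kclean_colon => // Cv.
  (* If [v] were in the radical of [I : u], then 1 would lie in the colon of that radical by [v],
     which equals the colon of the radical of [I] by [v]. *)
  apply: nJv; rewrite -[mono K v]mul1r -[radical I _]/(colon (radical I) (mono K v) 1).
  by rewrite -(radical_colon iI vE) /colon mul1r.
apply: (@kclean_step _ _ _ _ v) => //.
- by split=> // -[m]; rewrite expr1n; case: prI.
- move=> P; split; first exact: ass_prime_radical.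
  by apply: min_prime_ass => //; apply: kclean_no_embedded; [exact: cJC|exact: cJA].
- split=> [/mono_eq1 v0|].
    apply: a1; rewrite -(mono_exp0 K n); congr mono.
    apply: functional_extensionality => i.
    by have := congr1 (fun f => f i) v0; rewrite /v; case: (a i).
  (* Minimal primes do not change under radicals, so the cleaner condition for [v] reduces to that
     for [u]. *)
  split=> // P; rewrite -addE => /min_prime_radical /mina mP.
  exact/min_prime_radical.
by apply: leq_trans (supp_card_le _) suppa => i; rewrite /v; case: (a i).
Qed.
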